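(* Let $n>2$ be an integer and let $T=\{t_{ij}\mid 1\le i<j\le n-1\}$, ordered by $t_{ij}<t_{kl}$ iff $i<k$, or $i=k$ and $j<l$; let $<$ also denote the corresponding deg-lex order on $T^*$. Let $S\subset Lie_{\mathbb Z}(T)$ be the set of the following Lie polynomials (all indices lying in $\{1,\dots,n-1\}$), where juxtaposition denotes the Lie bracket: (1) $t_{ij}t_{kl}$, for $k<i<j$, $k<l$, $l\ne i,j$; (2) $t_{jk}t_{ij}+t_{ik}t_{ij}$, for $i<j<k$; (3) $t_{jk}t_{ik}-t_{ik}t_{ij}$, for $i<j<k$. Then $S$ is a Gröbner–Shirshov basis for the Drinfeld–Kohno Lie algebra $\mathbf L_n=Lie_{\mathbb Z}(T\mid S)$; that is, $S$ is a Gröbner–Shirshov basis in the free Lie algebra $Lie_{\mathbb Z}(T)$.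
   Context: Drinfeld–Kohno Lie algebra. For $n>2$, $\mathbf L_n$ is the Lie algebra over $\mathbb Z$ with generators $t_{ij}=t_{ji}$ for distinct indices $1\le i,j\le n-1$ and relations $[t_{ij},t_{kl}]=0$ and $[t_{ij},t_{ik}+t_{jk}]=0$ for distinct $i,j,k,l$. It has the presentation $\mathbf L_n=Lie_{\mathbb Z}(T\mid S)=Lie_{\mathbb Z}(T)/Id(S)$ with $T$ and $S$ as in the claim, where $Id(S)$ is the Lie ideal generated by $S$. Orders. Let $X$ be a well-ordered set and $X^*$ the free monoid on $X$. Lex order $\succ$: $1\succ t$ for every $t\ne 1$; and if $u=x_iu'$, $v=x_jv'$ with $x_i,x_j\in X$, then $u\succ v$ iff $x_i>x_j$, or $x_i=x_j$ and $u'\succ v'$. Deg-lex order $>$: $u>v$ iff $\deg u>\deg v$, or $\deg u=\deg v$ and $u\succ v$, where $\deg$ is word length. Free Lie algebra. $Lie_{\mathbb Z}(X)$ is the free Lie algebra over $\mathbb Z$ on $X$, regarded as the Lie subalgebra generated by $X$ in the free associative algebra $\mathbb Z\langle X\rangle$ with bracket $[u,v]=uv-vu$. For nonzero $f\in\mathbb Z\langle X\rangle$, $\bar f\in X^*$ is its leading (largest) word in the deg-lex order; $f$ is monic if the coefficient of $\bar f$ is $1$. Lyndon–Shirshov words. A word $w\in X^*\setminus\{1\}$ is an associative Lyndon–Shirshov word (ALSW) if $w=uv$ with $u,v\ne1$ implies $w>vu$. Each ALSW $w$ has a standard bracketing $[w]$: $[w]=w$ if $\deg w=1$, and otherwise $[w]=[[u][v]]$,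 where $w=uv$ and $v$ is the longest proper suffix of $w$ that is an ALSW. Special bracketing. Let $w=aub$ with $w,u$ ALSWs. Then one can write $b=cd$ (possibly $c=1$) so that $[uc]$ occurs as a bracketed subword of $[w]$ at this place, $[w]=[a[uc]d]$ (for definiteness, take $c$ of minimal length). Write $c=c_1c_2\cdots c_n$ with each $c_i$ an ALSW and $c_1\preceq c_2\preceq\cdots\preceq c_n$. Replacing $[uc]$ in $[w]$ by $[\cdots[[[u][c_1]][c_2]]\cdots[c_n]]$ gives the special bracketing $[w]_u$ of $w$ relative to $u$; its leading word is $w$. Normal $S$-words. Let $S\subset Lie_{\mathbb Z}(X)$ be a set of monic polynomials. For $s\in S$ and $a,b\in X^*$ such that $a\bar sb$ is an ALSW, $[asb]_{\bar s}$ denotes the Lie polynomial obtained from $[a\bar sb]_{\bar s}$ by replacing the bracketed subword $[\bar s]$ by $s$. More generally, an $S$-word $(asb)$ is obtained from any bracketing of the word $a\,s\,b$ in which $s\in S$ is treated as a single letter, with brackets evaluated in $Lie_{\mathbb Z}(X)$; it is a normal $S$-word if its leading word is $a\bar sb$. Compositions. For $f,g\in S$: (i) if $w=\bar f=a\bar gb$ for some $a,b\in X^*$, the composition of inclusion is $(f,g)_w=f-[agb]_{\bar g}$; (ii) if $w=\bar fb=a\bar g$ for some $a,b\in X^*$ with $\deg\bar f+\deg\bar g>\deg w$, the composition of intersection is $(f,g)_w=[fb]_{\bar f}-[ag]_{\bar g}$. A Lie polynomial $h$ is trivial modulo $(S,w)$ if $h=\sum_i\alpha_i(a_is_ib_i)$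 (a finite sum) with $\alpha_i\in\mathbb Z$, each $(a_is_ib_i)$ a normal $S$-word and $a_i\bar s_ib_i<w$. The set $S$ is a Gröbner–Shirshov basis in $Lie_{\mathbb Z}(X)$ if every composition $(f,g)_w$ of elements $f,g\in S$ is trivial modulo $(S,w)$. *)

(* Defs.v *)
From HB Require Import structures.
From mathcomp Require Import all_boot all_order all_algebra.
From mathcomp Require Import finmap monalg.

Set Implicit Arguments.
Unset Strict Implicit.
Unset Printing Implicit Defensive.

Import Order.TTheory GRing.Theory.
Local Open Scope ring_scope.

Notation freeAlg X := {malg int[{fmonom X}]}.

Definition letter (X : choiceType) (x : X) : freeAlg X := << fmu x >>.

Definition lieb (X : choiceType) (p q : freeAlg X) : freeAlg X :=
  p * q - q * p.

Inductive lie_poly (X : choiceType) : freeAlg X -> Prop :=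
| lie_letter x : lie_poly (letter x)
| lie_zero : lie_poly 0
| lie_sub p q : lie_poly p -> lie_poly q -> lie_poly (p - q)
| lie_bracket p q : lie_poly p -> lie_poly q -> lie_poly (lieb p q).

Inductive lie_ideal (X : choiceType) (S : freeAlg X -> Prop) :
  freeAlg X -> Prop :=
| ideal_gen s : S s -> lie_ideal S s
| ideal_zero : lie_ideal S 0
| ideal_sub p q : lie_ideal S p -> lie_ideal S q -> lie_ideal S (p - q)
| ideal_bracket p q : lie_poly p -> lie_ideal S q -> lie_ideal S (lieb p q).

(* Bracketings of nonempty words, and bracketings with exactly one hole. *)

Inductive btree (X : Type) : Type :=
| Leaf of X
| Node of btree X & btree X.

Inductive bctx (X : Type) : Type :=
| Hole
| CtxL of bctx X & btree X
| CtxR of btree X & bctx X.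

Arguments Hole {X}.

Fixpoint foliage (X : Type) (t : btree X) : seq X :=
  match t with
  | Leaf x => [:: x]
  | Node l r => foliage l ++ foliage r
  end.

Fixpoint ctx_left (X : Type) (C : bctx X) : seq X :=
  match C with
  | Hole => [::]
  | CtxL C' _ => ctx_left C'
  | CtxR l C' => foliage l ++ ctx_left C'
  end.

Fixpoint ctx_right (X : Type) (C : bctx X) : seq X :=
  match C with
  | Hole => [::]
  | CtxL C' r => ctx_right C' ++ foliage r
  | CtxR _ C' => ctx_right C'
  end.

Fixpoint ctx_comp (X : Type) (C D : bctx X) : bctx X :=
  match C with
  | Hole => D
  | CtxL C' r => CtxL (ctx_comp C' D) r
  | CtxR l C' => CtxR l (ctx_comp C' D)
  end.

Fixpoint beval (X : choiceType) (t : btree X) : freeAlg X :=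
  match t with
  | Leaf x => letter x
  | Node l r => lieb (beval l) (beval r)
  end.

Fixpoint fill (X : choiceType) (C : bctx X) (p : freeAlg X) : freeAlg X :=
  match C with
  | Hole => p
  | CtxL C' r => lieb (fill C' p) (beval r)
  | CtxR l C' => lieb (beval l) (fill C' p)
  end.

(* All bracketed subwords of [t] with their places, each one listed before
   the bracketed subwords strictly inside it. *)
Fixpoint occurrences (X : Type) (t : btree X) : seq (bctx X * btree X) :=
  (Hole, t) ::
  match t with
  | Leaf _ => [::]
  | Node l r => [seq (CtxL o.1 r, o.2) | o <- occurrences l]
             ++ [seq (CtxR l o.1, o.2) | o <- occurrences r]
  end.

Section Words.
Context {d : Order.disp_t} {X : orderType d}.
Implicit Types (u v w a b c : seq X) (p s f g h : freeAlg X).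

(* The empty word is the largest one, unlike in the usual lexicographic
   order. *)
Fixpoint lex_gt u v : bool :=
  match u, v with
  | _, [::] => false
  | [::], _ :: _ => true
  | x :: u', y :: v' => (y < x)%O || (x == y) && lex_gt u' v'
  end.

Definition lex_le u v : bool := (u == v) || lex_gt v u.

Definition deglex_gt u v : bool :=
  (size v < size u)%N || (size u == size v) && lex_gt u v.

(* The leading word; its value is the empty word for the zero polynomial. *)
Definition lead p : {fmonom X} :=
  \big[(fun u v : {fmonom X} => if deglex_gt v u then v else u)
     /mone]_(u <- msupp p) u.

Definition monic_pol p : Prop := p@_(lead p) = 1.

Definition alsw w : bool :=
  (w != [::]) && all (fun i => deglex_gt w (rot i w)) (iota 1 (size w).-1).

(* [k] is the smallest positive number such that the suffix of [x :: w] from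
   position [k] on is an ALSW; the first argument bounds the recursion
   depth. *)
Fixpoint std_rec (m : nat) (x : X) w : btree X :=
  if m is m'.+1 then
    let k := (find (fun i => alsw (drop i (x :: w))) (iota 1 (size w))).+1 in
    match take k (x :: w), drop k (x :: w) with
    | y :: u, z :: v => Node (std_rec m' y u) (std_rec m' z v)
    | _, _ => Leaf x
    end
  else Leaf x.

(* The standard bracketing; the empty word has none. *)
Definition std w : option (btree X) :=
  if w is x :: w' then Some (std_rec (size w) x w') else None.

Fixpoint factorizations w : seq (seq (seq X)) :=
  if w is x :: w' then
    flatten [seq match cs with
                 | [::] => [:: [:: [:: x]]]
                 | c :: cs' => [:: (x :: c) :: cs'; [:: x] :: cs]
                 end | cs <- factorizations w']
  else [:: [::]].

Definition alsw_factors c : seq (seq X) :=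
  head [::] [seq cs <- factorizations c | all alsw cs && sorted lex_le cs].

(* The bracketed subwords of [[aub]] that start right after [a] are nested,
   so the last one listed that still contains [u] is [[uc]] with [c] of
   minimal length. *)
Definition special_place a u b : bctx X * seq X :=
  if std (a ++ u ++ b) is Some t then
    let o := last (Hole, t)
      [seq o <- occurrences t | (ctx_left o.1 == a) && prefix u (foliage o.2)] in
    (o.1, drop (size u) (foliage o.2))
  else (Hole, [::]).

(* The special bracketing of [aub] relative to [u], with a hole in place of
   the bracketed subword [[u]]. *)
Definition special_ctx a u b : bctx X :=
  let: (C, c) := special_place a u b in
  ctx_comp C (foldl (@CtxL X) Hole (pmap std (alsw_factors c))).

Definition special_subst a s b : freeAlg X :=
  fill (special_ctx a (lead s) b) s.

Variant composition f g : seq X -> freeAlg X -> Prop :=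
| CompInclusion a b of (lead f : seq X) = a ++ lead g ++ b :
    composition f g (lead f) (f - special_subst a g b)
| CompIntersection a b of
    lead f ++ b = a ++ lead g &
    (size (lead f ++ b) < size (lead f) + size (lead g))%N :
    composition f g (lead f ++ b)
      (special_subst [::] f b - special_subst a g [::]).

(* The bracketing [C] of the word [a s b], with [s] treated as a letter,
   gives a normal S-word. *)
Definition normal_word (C : bctx X) s : Prop :=
  fill C s != 0 /\
  (lead (fill C s) : seq X) = ctx_left C ++ lead s ++ ctx_right C.

Inductive trivial_mod (S : freeAlg X -> Prop) w : freeAlg X -> Prop :=
| triv_zero : trivial_mod S w 0
| triv_add (alpha : int) (C : bctx X) s h :
    S s -> normal_word C s ->
    deglex_gt w (ctx_left C ++ lead s ++ ctx_right C) ->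
    trivial_mod S w h ->
    trivial_mod S w (alpha *: fill C s + h).

Definition GS_basis (S : freeAlg X -> Prop) : Prop :=
  (forall s, S s -> lie_poly s /\ monic_pol s) /\
  (forall f g w h, S f -> S g -> composition f g w h -> trivial_mod S w h).

(* [S] is a Groebner-Shirshov basis for the Lie algebra with generators [X]
   and defining relations [R]: in addition, [S] generates the same Lie ideal
   as [R], so that the two presentations define the same quotient. *)
Definition GS_basis_for (R S : freeAlg X -> Prop) : Prop :=
  GS_basis S /\ (forall h, lie_ideal S h <-> lie_ideal R h).

End Words.

Fact dkT_display : Order.disp_t. Proof. exact: Order.Disp tt tt. Qed.

Section DrinfeldKohno.
Variable n : nat.

(* The letters t_ij, as the pairs (i, j) with the lexicographic order. *)
Record dkT : predArgType := DKT {
  dk_pair : nat *l nat;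
  dk_pairP : [&& 0 < dk_pair.1, dk_pair.1 < dk_pair.2 & dk_pair.2 <= n.-1]%N
}.

HB.instance Definition _ := [isSub for dk_pair].
HB.instance Definition _ := [Choice of dkT by <:].
HB.instance Definition _ := [SubChoice_isSubOrder of dkT by <: with dkT_display].

(* Total and symmetric in [i] and [j]; the value 0 is taken only when [i = j]
   or an index is out of range. *)
Definition dkt (i j : nat) : freeAlg dkT :=
  if insub (minn i j, maxn i j) is Some x then letter (x : dkT) else 0.

Definition idx (i : nat) : bool := (0 < i <= n.-1)%N.

Variant dk_relation : freeAlg dkT -> Prop :=
| DKcomm i j k l of all idx [:: i; j; k; l] & uniq [:: i; j; k; l] :
    dk_relation (lieb (dkt i j) (dkt k l))
| DKtriple i j k of all idx [:: i; j; k] & uniq [:: i; j; k] :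
    dk_relation (lieb (dkt i j) (dkt i k + dkt j k)).

Variant dk_basis : freeAlg dkT -> Prop :=
| DKS1 i j k l of all idx [:: i; j; k; l] &
    (k < i < j)%N & (k < l)%N & l != i & l != j :
    dk_basis (lieb (dkt i j) (dkt k l))
| DKS2 i j k of all idx [:: i; j; k] & (i < j < k)%N :
    dk_basis (lieb (dkt j k) (dkt i j) + lieb (dkt i k) (dkt i j))
| DKS3 i j k of all idx [:: i; j; k] & (i < j < k)%N :
    dk_basis (lieb (dkt j k) (dkt i k) - lieb (dkt i k) (dkt i j)).

End DrinfeldKohno.

Arguments dk_relation n _ : clear implicits.
Arguments dk_basis n _ : clear implicits.

(* Main.v *)
Require Import Defs.
From mathcomp Require Import all_boot.
From mathcomp Require Import all_order all_algebra finmap monalg zify.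

(* Every leading word of S is a product xy of two letters x = t_ab, y = t_kl
   with k < a, and each such pair is the leading word of exactly one element.
   Hence, apart from the trivial compositions of an element with itself, the
   only compositions are the intersections on w = xyz with x = t_ab, y = t_kl,
   z = t_pq, p < k < a; they equal [f, z] - [x, g].  Up to brackets [s, t] with
   s in S and t a letter, every t_jk with j, k > p acts on the letters t_p* by
   [t_jk, t_pq] = - [t_{p,sigma q}, t_pq], where sigma is the transposition
   (j k).  By the Jacobi identity the composition becomes a combination of such
   brackets [s, t], all of them smaller than w, plus a cubic Lie polynomial in
   the letters t_p*, which vanishes in the free Lie algebra. *)

Set Implicit Arguments.
Unset Strict Implicit.
Unset Printing Implicit Defensive.

Import Order.TTheory GRing.Theory.
Local Open Scope ring_scope.

(* The tactic [ring] needs commutativity; [nc_ring] below decides identities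
   between noncommutative polynomials by comparing multisets of words. *)
Inductive nc_expr :=
| NCVar of nat
| NCAdd of nc_expr & nc_expr
| NCOpp of nc_expr
| NCMul of nc_expr & nc_expr.

(* The positive and the negative monomials of an expression. *)
Fixpoint nc_norm (e : nc_expr) : seq (seq nat) * seq (seq nat) :=
  match e with
  | NCVar i => ([:: [:: i]], [::])
  | NCAdd e1 e2 =>
      let: (p1, n1) := nc_norm e1 in let: (p2, n2) := nc_norm e2 in
      (p1 ++ p2, n1 ++ n2)
  | NCOpp e1 => let: (p1, n1) := nc_norm e1 in (n1, p1)
  | NCMul e1 e2 =>
      let: (p1, n1) := nc_norm e1 in let: (p2, n2) := nc_norm e2 in
      ([seq u ++ v | u <- p1, v <- p2] ++ [seq u ++ v | u <- n1, v <- n2],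
       [seq u ++ v | u <- p1, v <- n2] ++ [seq u ++ v | u <- n1, v <- p2])
  end.

Section NCEval.
Variables (R : pzRingType) (env : seq R).

Fixpoint nc_eval (e : nc_expr) : R :=
  match e with
  | NCVar i => env`_i
  | NCAdd e1 e2 => nc_eval e1 + nc_eval e2
  | NCOpp e1 => - nc_eval e1
  | NCMul e1 e2 => nc_eval e1 * nc_eval e2
  end.

Let mon (w : seq nat) : R := \prod_(i <- w) env`_i.
Let msum (ws : seq (seq nat)) : R := \sum_(w <- ws) mon w.

Let msumM us vs : msum [seq u ++ v | u <- us, v <- vs] = msum us * msum vs.
Proof.
rewrite /msum big_allpairs_dep big_distrl; apply: eq_bigr => u _ /=.
by rewrite big_distrr; apply: eq_bigr => v _; rewrite /mon big_cat.
Qed.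

Let msum_cat us vs : msum (us ++ vs) = msum us + msum vs.
Proof. exact: big_cat. Qed.

Lemma nc_normE e : nc_eval e = msum (nc_norm e).1 - msum (nc_norm e).2.
Proof.
elim: e => [i|e1 IH1 e2 IH2|e IH|e1 IH1 e2 IH2] /=.
- by rewrite /msum big_seq1 /mon big_seq1 big_nil subr0.
- rewrite IH1 IH2; case: (nc_norm e1) (nc_norm e2) => [p1 n1] [p2 n2] /=.
  by rewrite !msum_cat opprD addrACA.
- by rewrite IH; case: (nc_norm e) => p m /=; rewrite opprB.
- rewrite IH1 IH2; case: (nc_norm e1) (nc_norm e2) => [p1 n1] [p2 n2] /=.
  rewrite !msum_cat !msumM mulrBl !mulrBr opprB opprD !addrA.
  by rewrite (addrAC (msum p1 * msum p2)).
Qed.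

(** Negative monomials are moved to the other side, so no cancellation has to be computed. For
    concrete expressions the hypothesis is a closed boolean, which [isT] proves by conversion. *)
Lemma nc_eqP e1 e2 :
  (let: (p1, n1) := nc_norm e1 in let: (p2, n2) := nc_norm e2 in
   perm_eq (p1 ++ n2) (p2 ++ n1)) -> nc_eval e1 = nc_eval e2.
Proof.
rewrite !nc_normE; case: (nc_norm e1) (nc_norm e2) => [p1 n1] [p2 n2] /= eq12.
apply/eqP; rewrite subr_eq addrAC eq_sym subr_eq eq_sym.
by rewrite -!msum_cat; apply/eqP/perm_big.
Qed.
End NCEval.

Ltac nc_index x l :=
  match l with
  | x :: _ => constr:(0%N)
  | _ :: ?l' => let i := nc_index x l' in constr:(S i)
  end.

Ltac nc_mem x l :=
  match l with
  | nil => constr:(false)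
  | x :: _ => constr:(true)
  | _ :: ?l' => nc_mem x l'
  end.

Ltac nc_atoms t l :=
  match t with
  | ?a + ?b => let l := nc_atoms a l in nc_atoms b l
  | - ?a => nc_atoms a l
  | ?a * ?b => let l := nc_atoms a l in nc_atoms b l
  | _ => match nc_mem t l with true => l | false => constr:(t :: l) end
  end.

Ltac nc_reify t l :=
  match t with
  | ?a + ?b =>
      let a := nc_reify a l in let b := nc_reify b l in constr:(NCAdd a b)
  | - ?a => let a := nc_reify a l in constr:(NCOpp a)
  | ?a * ?b =>
      let a := nc_reify a l in let b := nc_reify b l in constr:(NCMul a b)
  | _ => let i := nc_index t l in constr:(NCVar i)
  end.

Ltac nc_ring :=
  match goal with |- @eq ?T ?a ?b =>
    let l := nc_atoms a (@nil T) in
    let l := nc_atoms b l in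
    let ea := nc_reify a l in
    let eb := nc_reify b l in
    exact: (@nc_eqP _ l ea eb isT)
  end.

(** * Leading words in the deg-lex order *)

Section Leading.
Context {d : Order.disp_t} {X : orderType d}.
Implicit Types (u v w : seq X) (p q r : freeAlg X).

Definition word u : freeAlg X := << FMonom u >>.

Lemma letterE (x : X) : letter x = word [:: x].
Proof. by rewrite /letter fmuE. Qed.

Lemma wordM u v : word u * word v = word (u ++ v).
Proof.
rewrite /word malgM_def fgmulUU mulr1.
by congr << _ >>; exact: fmmulE.
Qed.

Lemma lex_gtxx u : lex_gt u u = false.
Proof. by elim: u => //= x u ->; rewrite ltxx eqxx. Qed.

Lemma lex_gt_asym u v : lex_gt u v -> lex_gt v u = false.
Proof.
elim: u v => [|x u IH] [|y v] //= /orP[yx|/andP[/eqP -> /IH ->]].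
  by rewrite (lt_gtF yx) /= (lt_eqF yx).
by rewrite ltxx andbF.
Qed.

Lemma deglex_gtxx u : deglex_gt u u = false.
Proof. by rewrite /deglex_gt ltnn lex_gtxx andbF. Qed.

Lemma deglex_gt_asym u v : deglex_gt u v -> deglex_gt v u = false.
Proof.
rewrite /deglex_gt => /orP[lt_vu|/andP[/eqP -> /lex_gt_asym ->]].
  by rewrite ltnNge ltnW //= (ltn_eqF lt_vu).
by rewrite ltnn andbF.
Qed.

(** Quantifying over the support instead of using [lead p] lets [p = 0] satisfy the condition and
    makes it stable under sums. *)
Definition below w p := forall m, m \in msupp p -> deglex_gt w (m : seq X).

Lemma belowD w p q : below w p -> below w q -> below w (p + q).
Proof.
move=> wp wq m /(fsubsetP (msuppD_le p q)).
by rewrite in_fsetU => /orP[/wp|/wq].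
Qed.

Lemma belowN w p : below w p -> below w (- p).
Proof. by move=> wp m; rewrite msuppN => /wp. Qed.

Lemma below_word w u : deglex_gt w u -> below w (word u).
Proof. by move=> wu m; rewrite /word msuppU1 in_fset1 => /eqP ->. Qed.

Lemma lead_eq w p : p@_(FMonom w) != 0 ->
  (forall m, m \in msupp p -> m = FMonom w \/ deglex_gt w (m : seq X)) ->
  lead p = FMonom w.
Proof.
rewrite mcoeff_neq0 /lead => wp top; move: wp.
set s : seq _ := enum_fset (msupp p).
have {}top m : m \in s -> m = FMonom w \/ deglex_gt w m by apply: top.
rewrite -[_ \in msupp p]/(FMonom w \in s).
elim: s top => //= m s IH top; rewrite big_cons inE.
set t := \big[_/_]_(u <- s) u in IH *.
(* The fold over the tail returns a word of the support or its initial value, the empty word;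
   neither can exceed [w]. *)
have t_top : t = mone \/ t \in s.
  rewrite /t; elim: (s) => [|u s' IHs]; first by rewrite big_nil; left.
  rewrite big_cons inE; case: ifP => _; last by right; rewrite eqxx.
  by case: IHs => ->; [left | right; rewrite orbT].
case/predU1P=> [wm|ws]; last first.
  have -> : t = FMonom w by apply: IH => // u us; apply: top; rewrite inE us orbT.
  have [->|wm] := top m (mem_head _ _); first by case: ifP.
  by rewrite wm.
case: ifP => // mt; exfalso; move: mt; rewrite -wm.
case: t_top => [->|ts]; first by rewrite fm1; case: (w).
have [->|/deglex_gt_asym ->//] := top t (mem_behead (s := m :: s) ts).
by rewrite deglex_gtxx.
Qed.
End Leading.

(** * Quadratic Lie polynomials and their brackets with a letter *)

Section Quadratic.
Context {d : Order.disp_t} {X : orderType d}.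
Implicit Types (x y z u v c e : X) (w : seq X) (p q r s h : freeAlg X).

Lemma lead_below p w r : p = word w + r -> below w r ->
  lead p = FMonom w /\ p@_(FMonom w) = 1.
Proof.
move=> -> wr.
have rw0 : r@_(FMonom w) = 0.
  by apply: mcoeff_outdom; apply/negP => /wr; rewrite deglex_gtxx.
have w1 : (word w + r)@_(FMonom w) = 1 by rewrite mcoeffD mcoeffUU rw0 addr0.
split; last exact: w1.
apply: lead_eq; first by rewrite w1.
move=> m /(fsubsetP (msuppD_le _ _)); rewrite in_fsetU msuppU1 in_fset1.
by case/orP=> [/eqP|/wr]; [left|right].
Qed.

Lemma normal_below C p w r : fill C p = word w + r -> below w r ->
  w = ctx_left C ++ lead p ++ ctx_right C -> normal_word C p.
Proof.
move=> E wr wE; have [lp cp] := lead_below E wr.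
split; last by rewrite lp.
by apply: contra_eq_neq cp => ->; rewrite mcoeff0.
Qed.

(** Common shape of (1), (2) and (3): for (1) take [c = e], so that the second bracket vanishes. *)
Definition quad u v c e : freeAlg X :=
  lieb (letter u) (letter v) + lieb (letter c) (letter e).

Lemma lt_deglex_gt x y (u v : seq X) :
  size u = size v -> (y < x)%O -> deglex_gt (x :: u) (y :: v).
Proof. by move=> /= uv yx; rewrite /deglex_gt /= uv ltnn eqxx yx. Qed.

Lemma eq_deglex_gt x (u v : seq X) :
  deglex_gt (x :: u) (x :: v) = deglex_gt u v.
Proof. by rewrite /deglex_gt /= eqxx ltxx eqSS ltnS. Qed.

Section Lead.
Variables u v c e : X.
Hypotheses (vu : (v < u)%O) (cu : (c < u)%O) (eu : (e < u)%O).

Ltac below_words := repeat match goal with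
  | |- below _ (_ + _) => apply: belowD
  | |- below _ (- _) => apply: belowN
  | |- below _ (word _) => apply: below_word
  end; first [by [] | by apply: lt_deglex_gt
    | by rewrite eq_deglex_gt; apply: lt_deglex_gt].

(** Words are split into products of letters, so that [nc_ring] sees only letters as atoms. *)
Ltac expand_words :=
  rewrite -?[word [:: _; _; _]](wordM [:: _] [:: _; _]);
  rewrite -![word [:: _; _]](wordM [:: _] [:: _]) -!letterE /quad /lieb; nc_ring.

Lemma quad_word : quad u v c e = word [:: u; v]
  + (- word [:: v; u] + word [:: c; e] - word [:: e; c]).
Proof. expand_words. Qed.

Lemma lead_quad : lead (quad u v c e) = FMonom [:: u; v].
Proof. by have [|] := lead_below quad_word; first below_words. Qed.

Lemma monic_quad : monic_pol (quad u v c e).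
Proof.
rewrite /monic_pol lead_quad.
by have [|] := lead_below quad_word; first below_words.
Qed.

(** In the expansion only [u v y] starts with [u]; every other word starts with one of the smaller
    letters [v], [c], [e], [y]. *)
Lemma quad_normalL y :
  (y < u)%O -> normal_word (CtxL Hole (Leaf y)) (quad u v c e).
Proof.
move=> yu.
have E : fill (CtxL Hole (Leaf y)) (quad u v c e) = word [:: u; v; y]
    + (- word [:: v; u; y] + word [:: c; e; y] - word [:: e; c; y]
       - word [:: y; u; v] + word [:: y; v; u] - word [:: y; c; e]
       + word [:: y; e; c]).
  rewrite /=; expand_words.
by apply: (normal_below E); [below_words | rewrite lead_quad].
Qed.

(** For [u <= y] the word [y u v] takes over. If [u = y], its comparison with [u v y] is decided by
    the second letters. *)
Lemma quad_normalR y :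
  (u <= y)%O -> normal_word (CtxR (Leaf y) Hole) (quad u v c e).
Proof.
move=> uy.
have [vy cy ey] : [/\ v < y, c < y & e < y]%O by split; apply: lt_le_trans uy.
have uvy : deglex_gt [:: y; u; v] [:: u; v; y].
  have [->|uy'] := eqVneq u y; first by rewrite eq_deglex_gt; apply: lt_deglex_gt.
  by apply: lt_deglex_gt; rewrite // lt_neqAle uy'.
have E : fill (CtxR (Leaf y) Hole) (quad u v c e) = word [:: y; u; v]
    + (- word [:: y; v; u] + word [:: y; c; e] - word [:: y; e; c]
       - word [:: u; v; y] + word [:: v; u; y] - word [:: c; e; y]
       + word [:: e; c; y]).
  rewrite /=; expand_words.
by apply: (normal_below E); [below_words | rewrite lead_quad].
Qed.

End Lead.

Section TrivialMod.
Variables (S : freeAlg X -> Prop) (w : seq X).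

Lemma trivial_modD p q :
  trivial_mod S w p -> trivial_mod S w q -> trivial_mod S w (p + q).
Proof.
move=> Tp Tq; elim: Tp => [|a C s h Ss Cs wC _ IH]; first by rewrite add0r.
by rewrite -addrA; apply: triv_add.
Qed.

Lemma trivial_modN p : trivial_mod S w p -> trivial_mod S w (- p).
Proof.
elim=> [|a C s h Ss Cs wC _ IH]; first by rewrite oppr0; apply: triv_zero.
by rewrite opprD -scaleNr; apply: triv_add.
Qed.

(** Up to sign the bracket is a normal word with leading word [u v y] or [y u v], depending on
    whether [y < u]; bounding both words by [w] spares the caller this distinction. *)
Lemma trivial_mod_quad u v c e y : (v < u)%O -> (c < u)%O -> (e < u)%O ->
  S (quad u v c e) ->
  deglex_gt w [:: u; v; y] -> deglex_gt w [:: y; u; v] ->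
  trivial_mod S w (lieb (quad u v c e) (letter y)).
Proof.
move=> vu cu eu Ss wl wr; have lq := lead_quad vu cu eu.
have [yu|uy] := ltP y u.
  have := @triv_add _ _ S w 1 _ _ _ Ss (quad_normalL vu cu eu yu).
  rewrite lq => /(_ 0); rewrite scale1r addr0; apply=> //; exact: triv_zero.
have := @triv_add _ _ S w (- 1) _ _ _ Ss (quad_normalR vu cu eu uy).
rewrite lq => /(_ 0); rewrite scaleN1r addr0 /= /lieb opprB.
by apply=> //; exact: triv_zero.
Qed.
End TrivialMod.

Lemma alsw2 x y : (y < x)%O -> alsw [:: x; y].
Proof. by move=> yx; rewrite /alsw /= lt_deglex_gt. Qed.

Lemma std2 x y : std [:: x; y] = Some (Node (Leaf x) (Leaf y)).
Proof. by []. Qed.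

(** The suffix [y z] is already an ALSW, so it is the longest proper one. *)
Lemma std3 x y z : (z < y)%O ->
  std [:: x; y; z] = Some (Node (Leaf x) (Node (Leaf y) (Leaf z))).
Proof. by move=> zy; rewrite /std /std_rec /= alsw2. Qed.

Lemma special_nil s x y :
  lead s = FMonom [:: x; y] -> special_subst [::] s [::] = s.
Proof.
move=> ls; rewrite /special_subst ls /special_ctx /special_place cats0 cat0s.
by rewrite std2 //= !eqxx.
Qed.

(** [x y] is not a bracketed subword of [[x[yz]]]: the special place is the whole word, with
    [c = z], and rebracketing gives [[[xy]z]]. *)
Lemma special_left s x y z : lead s = FMonom [:: x; y] -> (z < y)%O ->
  special_subst [::] s [:: z] = lieb s (letter z).
Proof.
move=> ls zy; rewrite /special_subst ls /special_ctx /special_place.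
by rewrite std3 //= !eqxx.
Qed.

(** Here [[yz]] does occur in [[x[yz]]], so [c] is empty. *)
Lemma special_right s x y z : lead s = FMonom [:: y; z] -> (z < y)%O ->
  special_subst [:: x] s [::] = lieb (letter x) s.
Proof.
move=> ls zy; rewrite /special_subst ls /special_ctx /special_place.
by rewrite std3 //= !eqxx /= !andbF.
Qed.

End Quadratic.

(** * Transpositions of indices and the cubic identity *)

Definition swap (j k q : nat) : nat :=
  if q == j then k else if q == k then j else q.

Lemma swapC j k q : swap j k q = swap k j q.
Proof. by rewrite /swap; case: eqP => [->|]; case: eqP. Qed.

Section CubicIdentity.
Variables (X : choiceType) (Z : nat -> freeAlg X).

Local Notation br x y := (lieb x y).
Local Notation act u pi i := (br u (Z i) + br (Z (pi i)) (Z i)).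

(* The value of [[Z i, Z j], u] when [Z m, u] = [Z (pi m), Z m] for all m. *)
Definition dact (pi : nat -> nat) i j :=
  br (br (Z (pi i)) (Z i)) (Z j) + br (Z i) (br (Z (pi j)) (Z j)).

(** Since [swap a b] fixes [k], the map [swap k (swap a b l)] is the conjugate of [swap k l] by it.
    Once the coincidences among the indices are decided, each case is a noncommutative polynomial
    identity. *)
Lemma dact_swap a b k l q : a != b -> k != a -> k != b -> l != k ->
  dact (swap k (swap a b l)) (swap k l q) q + dact (swap a b) (swap k l q) q =
  dact (swap k l) (swap a b q) q
    + dact (swap k l) (swap k (swap a b l) q) q.
Proof.
move=> /eqP ab /eqP ka /eqP kb /eqP lk; rewrite /dact /swap /lieb.
repeat match goal with |- context [?x == ?y] => is_var x; is_var y;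
  case: (x =P y) => ?; subst; try by [exfalso; congruence] end; nc_ring.
Qed.

(* Here [act u pi i] is an element of S with leading word [u (Z i)], and the
   [dact] terms form the cubic remainder, zero for the relevant swaps. *)
Lemma jacobi_dact x y y' s t t' q :
  br (act x s q) y + br (act y t (s q)) (Z q) - br (act y t q) (Z (s q))
    + br (act y' t' q) y + br (act y t (t' q)) (Z q)
    - br (act y t q) (Z (t' q)) - br (act y t q) y'
    - br (act y' t' (t q)) (Z q) + br (act y' t' q) (Z (t q))
    - br (act x s (t q)) (Z q) + br (act x s q) (Z (t q)) =
  br (br x y + br y' y) (Z q) - br x (act y t q)
    - ((dact t' (t q) q + dact s (t q) q)
       - (dact t (s q) q + dact t (t' q) q)).
Proof. rewrite /dact /lieb; nc_ring. Qed.

(** To be applied with [x], [y], [y'] equal to [t_ab], [t_kl], [t_{k,s l}] and [Z m] to [t_pm]: the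
    left side is then the composition, and each summand on the right is, up to sign, an element of S
    bracketed with a letter. *)
Lemma jacobi_swap x y y' a b k l q s t t' :
  s = swap a b -> t = swap k l -> t' = swap k (s l) ->
  a != b -> k != a -> k != b -> l != k ->
  br (br x y + br y' y) (Z q) - br x (act y t q) =
  br (act x s q) y + br (act y t (s q)) (Z q) - br (act y t q) (Z (s q))
    + br (act y' t' q) y + br (act y t (t' q)) (Z q)
    - br (act y t q) (Z (t' q)) - br (act y t q) y'
    - br (act y' t' (t q)) (Z q) + br (act y' t' q) (Z (t q))
    - br (act x s (t q)) (Z q) + br (act x s q) (Z (t q)).
Proof.
move=> -> -> -> ab ka kb lk.
have sub_cancel (A B C D : freeAlg X) : A = B - (C - D) -> C = D -> B = A.
  by move=> -> ->; rewrite subrr subr0.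
exact: sub_cancel (jacobi_dact _ _ _ _ _ _ _) (dact_swap _ ab ka kb lk).
Qed.
End CubicIdentity.

(** * Lie ideals *)

Section LieIdeal.
Variable X : choiceType.
Implicit Types (R S : freeAlg X -> Prop) (p q h : freeAlg X).

Lemma lieb_id p : lieb p p = 0.
Proof. exact: subrr. Qed.

Lemma lieb_opp p q : - lieb p q = lieb q p.
Proof. exact: opprB. Qed.

Lemma lie_idealN S p : lie_ideal S p -> lie_ideal S (- p).
Proof. by rewrite -sub0r; apply: ideal_sub; apply: ideal_zero. Qed.

Lemma lie_idealD S p q : lie_ideal S p -> lie_ideal S q -> lie_ideal S (p + q).
Proof. by move=> Sp /lie_idealN Sq; rewrite -(opprK q); apply: ideal_sub. Qed.

Lemma lie_ideal_trans R S h :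
  (forall s, S s -> lie_ideal R s) -> lie_ideal S h -> lie_ideal R h.
Proof.
move=> RS; elim=> [s /RS|| p q _ Rp _ Rq| p q pL _ Rq]; first by [].
- exact: ideal_zero.
- exact: ideal_sub Rp Rq.
- exact: ideal_bracket pL Rq.
Qed.
End LieIdeal.

(** * The set [dk_basis]: its compositions and the ideal it generates *)

Section DrinfeldKohnoBasis.
Variable n : nat.
Implicit Types (x y z : dkT n) (i j k l p q r s : nat).
Local Notation dkt := (@dkt n).
Local Notation idx := (idx n).

Lemma dkT_lt x y : ((dk_pair x).1 < (dk_pair y).1)%N -> (x < y)%O.
Proof.
case: x y => [[i j] ij] [[k l] kl] /= ik; rewrite -lt_val /= ltxi_pair leEnat.
by rewrite (ltnW ik) leqNgt ik.
Qed.

Lemma dktC i j : dkt i j = dkt j i.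
Proof. by rewrite /Defs.dkt minnC maxnC. Qed.

Lemma dkt_letter i j : idx i -> idx j -> i != j ->
  exists2 x, dkt i j = letter x & dk_pair x = (minn i j, maxn i j).
Proof.
rewrite /Defs.idx => /andP[i0 ni] /andP[j0 nj] ij.
rewrite /Defs.dkt; case: insubP => [x _ <-|].
  by exists x.
by case/negP; rewrite /=; lia.
Qed.

(* A uniform way of writing (1), (2) and (3): the second bracket vanishes
   unless q is j or k. *)
Definition dk_rel j k p q : freeAlg (dkT n) :=
  lieb (dkt j k) (dkt p q) + lieb (dkt p (swap j k q)) (dkt p q).

(** With [j < k], the cases [q = j], [q = k] and all other [q] give (2), (3) and (1)
    respectively. *)
Lemma dk_rel_basis j k p q : all idx [:: j; k; p; q] ->
  (p < j)%N -> (p < k)%N -> (p < q)%N -> j != k -> dk_basis n (dk_rel j k p q).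
Proof.
wlog jk : j k / (j < k)%N => [IH|].
  case: (ltnP j k) => [|kj]; first exact: IH.
  move=> ids pj pk pq jk; rewrite /dk_rel swapC (dktC j k) -/(dk_rel k j p q).
  by apply: IH => //; rewrite 1?ltn_neqAle 1?eq_sym ?jk //= andbCA.
rewrite /= andbT => /and4P[jn kn pn qn] pj pk pq _; rewrite /dk_rel /swap.
case: eqP => [->|/eqP qj].
  by apply: DKS2; rewrite /= ?jn ?kn ?pn // pj.
case: eqP => [->|/eqP qk].
  rewrite -(lieb_opp (dkt p k) (dkt p j)).
  by apply: DKS3; rewrite /= ?jn ?kn ?pn // pj.
rewrite lieb_id addr0; apply: DKS1 => //; last by rewrite pj.
by rewrite /= jn kn pn qn.
Qed.

Lemma dk_basisP h : dk_basis n h -> exists j k p q,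
  [/\ all idx [:: j; k; p; q], [/\ p < j, j < k & p < q]%N & h = dk_rel j k p q].
Proof.
case=> {h} [i j k l ids /andP[ki ij] kl li lj
          |i j k ids /andP[ij jk]|i j k ids /andP[ij jk]].
- exists i, j, k, l; split=> //.
  by rewrite /dk_rel /swap (negbTE li) (negbTE lj) lieb_id addr0.
- exists j, k, i, j; rewrite /dk_rel /swap eqxx; split=> //.
  by move: ids => /=; do 3!case: idx.
- exists j, k, i, k; rewrite /dk_rel /swap eqxx (gtn_eqF jk) lieb_opp.
  split=> //; last by rewrite ij jk (ltn_trans ij jk).
  by move: ids => /=; do 3!case: idx.
Qed.

Lemma dk_rel_quad j k p q : all idx [:: j; k; p; q] ->
  (p < j)%N -> (p < k)%N -> (p < q)%N -> j != k ->
  exists u v c e, [/\ dk_rel j k p q = quad u v c e,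
    [/\ v < u, c < u & e < u]%O, dkt j k = letter u, dkt p q = letter v &
    dk_pair u = (minn j k, maxn j k) /\ dk_pair v = (p, q)].
Proof.
rewrite /= andbT => /and4P[jn kn pn qn] pj pk pq jk.
have [u uE up] := dkt_letter jn kn jk.
have [v vE vp] := dkt_letter pn qn (negbT (ltn_eqF pq)).
(* This makes [dkt p (swap j k q)] a letter rather than the default value 0. Its first index is [p],
   so it is smaller than [u]. *)
have [] : idx (swap j k q) /\ (p < swap j k q)%N.
  by rewrite /swap; case: eqP => // _; case: eqP.
rewrite /dk_rel; move: (swap j k q) => m mn pm.
have [c cE cp] := dkt_letter pn mn (negbT (ltn_eqF pm)).
exists u, v, c, v; rewrite cE uE vE; split; [exact: erefl| |by []..|].
  by split; apply: dkT_lt; rewrite up ?vp ?cp /= leq_min; lia.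
by rewrite vp (minn_idPl (ltnW pq)) (maxn_idPr (ltnW pq)).
Qed.

Lemma dkt_pair x i j : dk_pair x = (i, j) -> dkt i j = letter x.
Proof.
move=> xij; have := dk_pairP x; rewrite xij /= => /and3P[_ ij _].
by rewrite /Defs.dkt (minn_idPl (ltnW ij)) (maxn_idPr (ltnW ij)) -xij valK.
Qed.

(** Both [t_jk] and [t_rs] are smaller than [x], so the first letter alone puts the bracket below
    [x y z]. *)
Lemma dk_trivialL x y z j k p q r s : all idx [:: j; k; p; q; r; s] ->
  (p < j)%N -> (p < k)%N -> (p < q)%N -> j != k -> r != s ->
  (minn j k < (dk_pair x).1)%N -> (minn r s < (dk_pair x).1)%N ->
  trivial_mod (dk_basis n) [:: x; y; z] (lieb (dk_rel j k p q) (dkt r s)).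
Proof.
rewrite (all_cat _ [:: _; _; _; _]) => /andP[ids] /and3P[rn sn _].
move=> pj pk pq jk rs ux tx.
have [u [v [c [e [E [vu cu eu] _ _ [up vp]]]]]] := dk_rel_quad ids pj pk pq jk.
have [t -> tp] := dkt_letter rn sn rs.
rewrite E; apply: (trivial_mod_quad vu cu eu).
- by rewrite -E; exact: dk_rel_basis.
- by apply: (lt_deglex_gt _ (dkT_lt _)); rewrite ?up.
- by apply: (lt_deglex_gt _ (dkT_lt _)); rewrite ?tp.
Qed.

(** Now [t_jk] is [x] itself; the word starting with it is smaller than [x y z] in the second
    letter, as [t_pq < y]. *)
Lemma dk_trivialR x y z j k p q r s : all idx [:: j; k; p; q; r; s] ->
  (p < j < k)%N -> (p < q)%N -> r != s -> dk_pair x = (j, k) ->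
  (p < (dk_pair y).1)%N -> (minn r s < (dk_pair x).1)%N ->
  trivial_mod (dk_basis n) [:: x; y; z] (lieb (dk_rel j k p q) (dkt r s)).
Proof.
rewrite (all_cat _ [:: _; _; _; _]) => /andP[ids] /and3P[rn sn _].
move=> /andP[pj jk] pq rs xp py tx; have pk := ltn_trans pj jk.
have jk' := negbT (ltn_eqF jk).
have [u [v [c [e [E [vu cu eu] _ _ [up vp]]]]]] := dk_rel_quad ids pj pk pq jk'.
have [t -> tp] := dkt_letter rn sn rs.
have ux : u = x.
  by apply: val_inj; rewrite /= up xp (minn_idPl (ltnW jk)) (maxn_idPr (ltnW jk)).
rewrite E; apply: (trivial_mod_quad vu cu eu).
- by rewrite -E; exact: dk_rel_basis.
- by rewrite ux eq_deglex_gt; apply: (lt_deglex_gt _ (dkT_lt _)); rewrite ?vp.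
- by apply: (lt_deglex_gt _ (dkT_lt _)); rewrite ?tp.
Qed.

Lemma dk_composition_trivial x y z a b k l p q :
  dk_pair x = (a, b) -> dk_pair y = (k, l) -> dk_pair z = (p, q) ->
  (p < k < a)%N ->
  trivial_mod (dk_basis n) [:: x; y; z]
    (lieb (dk_rel a b k l) (dkt p q) - lieb (dkt a b) (dk_rel k l p q)).
Proof.
move=> xp yp zp /andP[pk ka].
have := (dk_pairP x, dk_pairP y, dk_pairP z); rewrite xp yp zp /=.
move=> [[/and3P[a0 ab bn] /and3P[k0 kl ln]] /and3P[p0 pq qn]].
have swP (P : pred nat) j i m : P j -> P i -> P m -> P (swap j i m).
  by move=> Pj Pi Pm; rewrite /swap; case: eqP => // _; case: eqP.
pose s := swap a b; pose t := swap k l; pose t' := swap k (s l).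
have /and4P[ne_ab ka' kb lk] : [&& a != b, k != a, k != b & l != k] by lia.
have -> : lieb (dk_rel a b k l) (dkt p q) - lieb (dkt a b) (dk_rel k l p q) =
    lieb (dk_rel a b p q) (dkt k l) + lieb (dk_rel k l p (s q)) (dkt p q)
    - lieb (dk_rel k l p q) (dkt p (s q)) + lieb (dk_rel k (s l) p q) (dkt k l)
    + lieb (dk_rel k l p (t' q)) (dkt p q) - lieb (dk_rel k l p q) (dkt p (t' q))
    - lieb (dk_rel k l p q) (dkt k (s l))
    - lieb (dk_rel k (s l) p (t q)) (dkt p q)
    + lieb (dk_rel k (s l) p q) (dkt p (t q))
    - lieb (dk_rel a b p (t q)) (dkt p q) + lieb (dk_rel a b p q) (dkt p (t q)).
  rewrite /dk_rel -/s -/t -/t'.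
  exact: (@jacobi_swap _ (dkt p) _ _ _ a b k l q s t t').
(* The transpositions preserve [P], so all permuted second indices still give letters [t_p*]. *)
pose P m := idx m && (p < m)%N.
have /and5P[Pa Pb Pk Pl Pq] : [&& P a, P b, P k, P l & P q].
  by rewrite /P /Defs.idx; lia.
(* In particular [s l] differs from [k], so [t_{k,s l}] is a letter. *)
have sl : idx (s l) && (k < s l)%N.
  by apply: (swP (fun m => idx m && (k < m)%N)); rewrite /Defs.idx; lia.
have Psl : P (s l) by apply: swP.
have Psq : P (s q) by apply: swP.
have Ptq : P (t q) by apply: swP.
have Pt'q : P (t' q) by apply: swP.
move: (s l) (s q) (t q) (t' q) sl Psl Psq Ptq Pt'q => {s t t' swP}.
rewrite /P /Defs.idx => sl sq tq t'q /= in_sl _ in_sq in_tq in_t'q.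
clear P Pa Pb Pk Pl Pq.
repeat match goal with
| |- trivial_mod _ _ (_ + _) => apply: trivial_modD
| |- trivial_mod _ _ (- _) => apply: trivial_modN
end.
all: first [apply: dk_trivialL; rewrite ?xp ?yp /= /Defs.idx; lia
  | apply: dk_trivialR; rewrite ?xp ?yp /= /Defs.idx; first [reflexivity | lia]].
Qed.

Lemma dk_basis_lead f : dk_basis n f -> exists a b k l x y,
  [/\ f = dk_rel a b k l, dk_pair x = (a, b), dk_pair y = (k, l), (k < a)%N &
      lead f = FMonom [:: x; y]].
Proof.
case/dk_basisP=> a [b [k [l [ids [ka ab kl] ->]]]].
have [u [v [c [e [E [vu cu eu] _ _ [up vp]]]]]] :=
  dk_rel_quad ids ka (ltn_trans ka ab) kl (negbT (ltn_eqF ab)).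
rewrite (minn_idPl (ltnW ab)) (maxn_idPr (ltnW ab)) in up.
have lq : lead (dk_rel a b k l) = FMonom [:: u; v].
  by rewrite E; exact: lead_quad.
by exists a, b, k, l, u, v; split; [exact: erefl|..].
Qed.

Lemma dk_basis_lie f : dk_basis n f -> lie_poly f /\ monic_pol f.
Proof.
case/dk_basisP=> a [b [k [l [ids [ka ab kl] ->]]]].
have [u [v [c [e [E [vu cu eu] _ _ _]]]]] :=
  dk_rel_quad ids ka (ltn_trans ka ab) kl (negbT (ltn_eqF ab)).
rewrite E; split; last exact: monic_quad.
rewrite /quad -[X in _ + X]opprK -[X in _ - X]sub0r.
have L x y : lie_poly (lieb (letter x) (letter y)).
  by apply: lie_bracket; apply: lie_letter.
exact: lie_sub (L _ _) (lie_sub (lie_zero _) (L _ _)).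
Qed.

Lemma dk_GS_basis : GS_basis (dk_basis n).
Proof.
split=> [s|f g w h Sf Sg]; first exact: dk_basis_lie.
have [a [b [k [l [x [y [fE xp yp ka lf]]]]]]] := dk_basis_lead Sf.
have [a' [b' [k' [l' [x' [y' [gE xp' yp' ka' lg]]]]]]] := dk_basis_lead Sg.
have yx' : (y' < x')%O by apply: dkT_lt; rewrite xp' yp'.
have same : x' = x -> y' = y -> g = f.
  move=> xx yy; move: xp' yp'; rewrite xx yy xp yp => -[aa bb] -[kk ll].
  rewrite fE gE aa bb kk ll; exact: erefl.
case=> [u v|u v].
  rewrite lf lg; case: u => [|? [|? []]] //= [xx yy vv]; case: v vv => // _.
  rewrite (special_nil lg) (same (esym xx) (esym yy)) subrr; exact: triv_zero.
(* Both leading words have length 2, so [u] and [v] have equal length, 0 or 1. Length 0 forces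
   [g = f] and composition 0; length 1 is the overlap in the single letter [y = x']. *)
rewrite lf lg /= => uv; have := congr1 size uv; rewrite size_cat /= addn2 => -[suv].
rewrite !ltnS => sv.
case: v sv uv suv => [|z []] //= _; case: u => [|? []] //= [].
  move=> xx yy _; rewrite (special_nil lf) (special_nil lg).
  rewrite (same (esym xx) (esym yy)) subrr; exact: triv_zero.
move=> <- yy zz _; rewrite -yy in yx' lg xp'; rewrite -zz in yx' lg yp' => {same}.
rewrite (special_left lf yx') (special_right x lg yx').
move: xp'; rewrite yp => -[kE lE]; rewrite -kE -lE in gE ka'.
rewrite -(dkt_pair yp') -(dkt_pair xp) fE gE.
by apply: (dk_composition_trivial xp yp yp'); rewrite ka' ka.
Qed.

Lemma dk_basis_in_ideal h : dk_basis n h -> lie_ideal (dk_relation n) h.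
Proof.
case=> {h} [i j k l ids /andP[ki ij] kl li lj
          |i j k ids /andP[ij jk]|i j k ids /andP[ij jk]].
- by apply/ideal_gen/DKcomm; rewrite //= !inE; lia.
- have -> : lieb (dkt j k) (dkt i j) + lieb (dkt i k) (dkt i j) =
    - lieb (dkt i j) (dkt i k + dkt j k) by rewrite /lieb; nc_ring.
  by apply/lie_idealN/ideal_gen/DKtriple; rewrite //= !inE; lia.
- have -> : lieb (dkt j k) (dkt i k) - lieb (dkt i k) (dkt i j) =
    - lieb (dkt i k) (dkt i j + dkt k j).
    by rewrite (dktC k j) /lieb; nc_ring.
  by apply/lie_idealN/ideal_gen/DKtriple; rewrite /= ?inE; move: ids => /=; lia.
Qed.

Lemma dk_rel_in_ideal j k p q : all idx [:: j; k; p; q] ->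
  (p < j)%N -> (p < k)%N -> (p < q)%N -> j != k ->
  lie_ideal (dk_basis n) (dk_rel j k p q).
Proof. by move=> ids pj pk pq jk; apply/ideal_gen/dk_rel_basis. Qed.

(** The cases follow the position of the smallest index. In a triple relation, if it is [k], the
    relation is a sum of two elements of S; if it is [i] or [j], the negative of a single one. *)
Lemma dk_relation_in_ideal h : dk_relation n h -> lie_ideal (dk_basis n) h.
Proof.
have comm i j k l : all idx [:: i; j; k; l] -> uniq [:: i; j; k; l] ->
    (k < i)%N -> (k < j)%N -> (k < l)%N ->
    lie_ideal (dk_basis n) (lieb (dkt i j) (dkt k l)).
  move=> ids; rewrite /= !inE => u ki kj kl.
  have := dk_rel_in_ideal ids ki kj kl.
  have /andP[/negbTE li /negbTE lj] : (l != i) && (l != j) by lia.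
  rewrite /dk_rel /swap li lj.
  by rewrite lieb_id addr0; apply; lia.
case=> {h} [i j k l|i j k] ids u.
- move: ids u; rewrite /= !inE => ids u.
  have [ki|ik] := ltnP (minn k l) (minn i j).
    have [kl|lk] := ltnP k l; last rewrite (dktC k l).
      by apply: comm; rewrite /= ?inE; lia.
    by apply: comm; rewrite /= ?inE; lia.
  rewrite -lieb_opp; apply: lie_idealN.
  have [ij|ji] := ltnP i j; last rewrite (dktC i j).
    by apply: comm; rewrite /= ?inE; lia.
  by apply: comm; rewrite /= ?inE; lia.
move: ids u; rewrite /= !inE => ids u.
have [kmin|kmax] := boolP ((k < i) && (k < j))%N.
  have -> : lieb (dkt i j) (dkt i k + dkt j k) =
      dk_rel i j k i + dk_rel i j k j.
    have ij : (j == i) = false by lia.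
    by rewrite /dk_rel /swap !eqxx ij (dktC i k) (dktC j k) /lieb; nc_ring.
  by apply: lie_idealD; apply: dk_rel_in_ideal; rewrite /=; lia.
have [ij|ji] := ltnP i j.
  have -> : lieb (dkt i j) (dkt i k + dkt j k) = - dk_rel j k i j.
    by rewrite /dk_rel /swap !eqxx /lieb; nc_ring.
  by apply/lie_idealN/dk_rel_in_ideal; rewrite /=; lia.
have -> : lieb (dkt i j) (dkt i k + dkt j k) = - dk_rel i k j i.
  by rewrite /dk_rel /swap !eqxx (dktC i j) /lieb; nc_ring.
by apply/lie_idealN/dk_rel_in_ideal; rewrite /=; lia.
Qed.

End DrinfeldKohnoBasis.

Theorem theorem4p2 (n : nat) (hn : (2 < n)%N) :
  GS_basis_for (dk_relation n) (dk_basis n).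
Proof.
split; first exact: dk_GS_basis.
move=> h; split; apply: lie_ideal_trans.
  exact: dk_basis_in_ideal.
exact: dk_relation_in_ideal.
Qed.
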